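(* Let $a,b\in\mathbb Z\cup\{-\infty,\infty\}$ and let $f=(f_n\colon n\in\overline{a,b})$ and $g=(g_n\colon n\in\overline{a,b})$ be real sequences such that $g$ takes no zero value and has constant sign on $\overline{a,b}$, and $\Delta g$ takes no zero value and has constant sign on $\overline{a+1,b}$. Let $r:=f/g$ on $\overline{a,b}$ and $\rho:=\Delta f/\Delta g$ on $\overline{a+1,b}$. Suppose that $\rho$ is either nondecreasing or nonincreasing on $\overline{a+1,b}$. Then: (1) if $\rho$ is nondecreasing and $g\,\Delta g>0$ on $\overline{a+1,b}$, then $r\searrow\nearrow$; (2) if $\rho$ is nonincreasing and $g\,\Delta g>0$ on $\overline{a+1,b}$, then $r\nearrow\searrow$; (3) if $\rho$ is nondecreasing and $g\,\Delta g<0$ on $\overline{a+1,b}$, then $r\nearrow\searrow$; (4) if $\rho$ is nonincreasing and $g\,\Delta g<0$ on $\overline{a+1,b}$, then $r\searrow\nearrow$. Here $r\searrow\nearrow$ means that there is some $k\in\overline{a,b}\cup\{a,b\}$ such that $r$ is nonincreasing on $\overline{a,k}$ and nondecreasing on $\overline{k,b}$; and $r\nearrow\searrow$ means that there is some $k\in\overline{a,b}\cup\{a,b\}$ such that $r$ is nondecreasing on $\overline{a,k}$ and nonincreasing on $\overline{k,b}$.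
   Context: For $a,b\in\mathbb Z\cup\{-\infty,\infty\}$, $\overline{a,b}:=\{n\in\mathbb Z\colon a\le n\le b\}$ (so it is empty if $a>b$, and no infinite endpoint belongs to it). By convention $\pm\infty+1:=\pm\infty$. For a sequence $f$ on $\overline{a,b}$, $\Delta f$ is the sequence on $\overline{a+1,b}$ given by $\Delta f_n:=(\Delta f)_n:=f_n-f_{n-1}$. Quotients and products of sequences are taken termwise: $r_n=f_n/g_n$, $\rho_n=\Delta f_n/\Delta g_n$, $(g\,\Delta g)_n=g_n\,\Delta g_n$. *)

(* Defs.v *)
From mathcomp Require Import all_boot all_order all_algebra.
From mathcomp Require Import all_classical reals constructive_ereal.

Set Implicit Arguments.
Unset Strict Implicit.
Unset Printing Implicit Defensive.

Import Order.TTheory GRing.Theory Num.Theory.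

Local Open Scope ring_scope.

(* The endpoints live in [\bar int]; [a + 1] taken there satisfies the
   convention that adding 1 to an infinite endpoint leaves it unchanged. *)
Definition zint (a b : \bar int) : pred int :=
  [pred n : int | (a <= n%:E)%E && (n%:E <= b)%E].

(* A sequence on [zint a b] is represented by a total function on [int]
   whose values outside [zint a b] are never constrained; accordingly
   [zdiff u] is meaningful only on [zint (a + 1) b]. *)
Definition zdiff (R : realType) (u : int -> R) : int -> R :=
  fun n => u n - u (n - 1).

Definition zquot (R : realType) (u v : int -> R) : int -> R :=
  fun n => u n / v n.

Definition nonzero_on (R : realType) (A : pred int) (u : int -> R) : Prop :=
  {in A, forall n, u n != 0}.

Definition constant_sign_on (R : realType) (A : pred int) (u : int -> R) :
    Prop :=
  {in A &, forall m n, Num.sg (u m) = Num.sg (u n)}.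

Definition nondecreasing_on (R : realType) (A : pred int) (u : int -> R) :
    Prop :=
  {in A &, forall m n : int, m <= n -> u m <= u n}.

Definition nonincreasing_on (R : realType) (A : pred int) (u : int -> R) :
    Prop :=
  {in A &, forall m n : int, m <= n -> u n <= u m}.

(* The switch point is an element of [zint a b] or one of the endpoints,
   which may be infinite. *)
Definition switch_point (a b k : \bar int) : Prop :=
  (exists2 n : int, n \in zint a b & k = n%:E) \/ k = a \/ k = b.

Definition down_up (R : realType) (a b : \bar int) (u : int -> R) : Prop :=
  exists k : \bar int, [/\ switch_point a b k,
    nonincreasing_on (zint a k) u & nondecreasing_on (zint k b) u].

Definition up_down (R : realType) (a b : \bar int) (u : int -> R) : Prop :=
  exists k : \bar int, [/\ switch_point a b k,
    nondecreasing_on (zint a k) u & nonincreasing_on (zint k b) u].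

(* Main.v *)
(* Write D for the difference operator and r = f / g, rho = Df / Dg.  From
   f = r g one gets
     (Dr)_n g_n^2 = (rho_n - r_(n-1)) (g Dg)_n  and
     (Dr)_n g_(n-1) g_n = (rho_n - r_n) (g Dg)_n.
   Since g_(n-1) g_n > 0, when g Dg > 0 the three numbers (Dr)_n,
   rho_n - r_(n-1) and rho_n - r_n have the same sign.  So if rho is
   nondecreasing and (Dr)_n >= 0, then rho_(n+1) >= rho_n >= r_n, whence
   (Dr)_(n+1) >= 0: once r rises it never falls again.  The other three cases
   follow by changing the signs of f and of r. *)
Require Import Defs.
From mathcomp Require Import all_boot all_order all_algebra.
From mathcomp Require Import all_classical reals constructive_ereal.
From mathcomp Require Import zify ring.

Set Implicit Arguments.
Unset Strict Implicit.
Unset Printing Implicit Defensive.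

Import Order.TTheory GRing.Theory Num.Theory.

Local Open Scope ring_scope.

(** The difference at [n] involves the indices [n - 1] and [n]; this trades its domain for theirs.
    For infinite [a] it rests on [a + 1 = a]. *)
Lemma zint_succE (a b : \bar int) (n : int) :
  (n \in zint (a + 1)%E b) = (n - 1 \in zint a b) && (n \in zint a b).
Proof.
rewrite !inE; case: a b => [a| |] [b| |] /=;
  rewrite -?EFinD ?lee_fin ?leey ?leNye ?leeNy_eq /= ?andbT ?andbF //=; lia.
Qed.

Lemma zint_convex (a b : \bar int) (m n p : int) :
  m \in zint a b -> p \in zint a b -> m <= n -> n <= p -> n \in zint a b.
Proof.
rewrite !inE => /andP[am _] /andP[_ pb] mn np; apply/andP; split.
  by apply: le_trans am _; rewrite lee_fin.
by apply: le_trans _ pb; rewrite lee_fin.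
Qed.

(** Since [a] may be infinite, the induction starts from an arbitrary [m] of the interval and runs
    on the distance [n - m]. *)
Lemma zint_ind (a b : \bar int) (P : int -> Prop) :
  (forall n, n \in zint a b -> n + 1 \in zint a b -> P n -> P (n + 1)) ->
  {in zint a b &, forall m n, m <= n -> P m -> P n}.
Proof.
move=> Pstep m n m_in n_in mn Pm.
have [d nE] : exists d : nat, n = m + d%:Z by exists `|n - m|%N; lia.
elim: d n nE n_in {mn} => [|d IHd] n nE n_in; first by rewrite nE addr0.
have d_in : m + d%:Z \in zint a b by apply: (zint_convex m_in n_in); lia.
have nE' : n = m + d%:Z + 1 by lia.
by rewrite nE'; apply: Pstep => //; [rewrite -nE' | exact: IHd].
Qed.

(** A discrete intermediate value argument, which will supply the finite switch points. *)
Lemma int_switch (P : int -> Prop) (p q : int) :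
  q <= p -> ~ P q -> P p -> exists n, [/\ q <= n, n < p, ~ P n & P (n + 1)].
Proof.
move=> qp; have [d pE] : exists d : nat, p = q + d%:Z by exists `|p - q|%N; lia.
elim: d p pE {qp} => [|d IHd] p pE nPq Pp; first by rewrite pE addr0 in Pp.
have pE' : p = q + d%:Z + 1 by lia.
have [Pd|nPd] := pselect (P (q + d%:Z)).
  by have [n [qn nd nPn Pn]] := IHd _ erefl nPq Pd; exists n; split=> //; lia.
by exists (q + d%:Z); split; rewrite -?pE' //; lia.
Qed.

Section Sequences.
Variable R : realType.
Implicit Types (a b : \bar int) (u f g : int -> R).

Lemma nondecreasing_on_succ a b u :
  {in zint (a + 1)%E b, forall n, u (n - 1) <= u n} ->
  nondecreasing_on (zint a b) u.
Proof.
move=> incr_u m n m_in n_in mn.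
apply: (zint_ind (P := fun p => u m <= u p) _ m_in n_in mn) => // p p_in p1_in.
move/le_trans; apply; have := incr_u (p + 1); rewrite zint_succE addrK; apply.
by rewrite p_in.
Qed.

Lemma nonincreasing_onN a b u :
  nonincreasing_on (zint a b) u <->
  nondecreasing_on (zint a b) (fun n => - u n).
Proof.
by split=> mono_u m n m_in n_in /(mono_u m n m_in n_in); rewrite lerN2.
Qed.

Lemma nondecreasing_onN a b u :
  nondecreasing_on (zint a b) u <->
  nonincreasing_on (zint a b) (fun n => - u n).
Proof.
by split=> mono_u m n m_in n_in /(mono_u m n m_in n_in); rewrite lerN2.
Qed.

Lemma nonincreasing_on_succ a b u :
  {in zint (a + 1)%E b, forall n, u n <= u (n - 1)} ->
  nonincreasing_on (zint a b) u.
Proof.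
move=> decr_u; apply/nonincreasing_onN/nondecreasing_on_succ => n n_in.
by rewrite lerN2 decr_u.
Qed.

Lemma up_downN a b u : down_up a b (fun n => - u n) -> up_down a b u.
Proof.
move=> [k [ks dec inc]]; exists k.
by split=> //; [apply/nondecreasing_onN | apply/nonincreasing_onN].
Qed.

(** For infinite [a] the interval is empty. When the switch point is an endpoint, this makes one of
    the two monotonicity conditions trivial. *)
Lemma zint_diag a (m n : int) : m \in zint a a -> n \in zint a a -> m = n.
Proof.
by rewrite !inE; case: a => [a| |]; rewrite ?lee_fin ?leeNy_eq ?andbF //=; lia.
Qed.

(** Rises form a final segment of the domain of differences. The switch point is [b] if there are
    none, [a] if every step is a rise, and otherwise the last index that is not a rise. *)
Lemma down_up_of_persistent_rise a b u :
  (forall n, n \in zint (a + 1)%E b -> n + 1 \in zint (a + 1)%E b ->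
    u (n - 1) <= u n -> u n <= u (n + 1)) ->
  down_up a b u.
Proof.
move=> rise_succ; set I1 := zint (a + 1)%E b.
pose rise n := u (n - 1) <= u n.
have rise_up : {in I1 &, forall m n, m <= n -> rise m -> rise n}.
  apply: zint_ind => n n_in n1_in; rewrite /rise addrK; exact: rise_succ.
have [no_rise|/existsNP[p /not_implyP[p_in /negP]]] :=
    pselect (forall n, n \in I1 -> ~~ rise n).
  exists b; split; first by right; right.
  - by apply: nonincreasing_on_succ => n /no_rise; rewrite -ltNge => /ltW.
  - by move=> m n m_in n_in _; rewrite (zint_diag m_in n_in).
rewrite negbK => rise_p.
have [all_rise|/existsNP[q /not_implyP[q_in nrise_q]]] :=
    pselect (forall n, n \in I1 -> rise n).
  exists a; split; first by right; left.
  - by move=> m n m_in n_in _; rewrite (zint_diag m_in n_in).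
  - exact: nondecreasing_on_succ.
have qp : q <= p.
  by case: (leP q p) => // /ltW pq; case: nrise_q; apply: rise_up rise_p.
have [k [qk kp nrise_k rise_k1]] := int_switch (P := rise) qp nrise_q rise_p.
have k_in1 : k \in I1 by apply: (zint_convex q_in p_in) => //; exact: ltW.
have k1_in1 : k + 1 \in I1 by apply: (zint_convex q_in p_in); lia.
have k_in : k \in zint a b by move: k_in1; rewrite zint_succE => /andP[].
have /andP[ak kb] := k_in.
exists k%:E; split; first by left; exists k.
  apply: nonincreasing_on_succ => n /andP[an nk].
  have n_in : n \in I1 by rewrite inE an (le_trans nk kb).
  (* A rise at some [n <= k] would persist up to [k]. *)
  apply: ltW; rewrite ltNge; apply/negP => rise_n; apply: nrise_k.
  by apply: rise_up rise_n => //; rewrite -lee_fin.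
apply: nondecreasing_on_succ => n.
rewrite zint_succE => /andP[/andP[kn1 nb1] /andP[kn nb]].
have n_in : n \in I1.
  rewrite zint_succE !inE nb nb1 (le_trans ak kn) !andbT.
  exact: le_trans ak kn1.
(* Differences on [zint k b] start at [k + 1], which is already a rise. *)
have k1n : k + 1 <= n by move: kn1; rewrite lee_fin; clear; lia.
exact: rise_up rise_k1.
Qed.

(* The factor [e], used at 1 and -1, lets the two signs of [g * zdiff g] share
   one argument. *)
Lemma quot_rise_rho (e f0 f1 g0 g1 : R) :
  g0 != 0 -> g1 != 0 -> g1 - g0 != 0 -> Num.sg g0 = Num.sg g1 ->
  0 < e * (g1 * (g1 - g0)) ->
  ((e * (f0 / g0) <= e * (f1 / g1)) =
     (f0 / g0 <= (f1 - f0) / (g1 - g0))) *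
  ((e * (f0 / g0) <= e * (f1 / g1)) =
     (f1 / g1 <= (f1 - f0) / (g1 - g0))).
Proof.
move=> g0N0 g1N0 dgN0 sg01 e_gt0.
have g11 : 0 < g1 * g1 by rewrite -expr2 exprn_even_gt0.
have g01 : 0 < g0 * g1.
  by rewrite -sgr_gt0 sgrM sg01 -sgrM sgr_gt0.
have same_sign (x y p q : R) :
    0 < p -> 0 < q -> x * p = y * q -> (0 <= x) = (0 <= y).
  by move=> p0 q0 xy; rewrite -(pmulr_lge0 x p0) xy pmulr_lge0.
split; rewrite -subr_ge0 -[RHS]subr_ge0.
  by apply: (same_sign _ _ _ _ g11 e_gt0); field; rewrite g0N0 g1N0 dgN0.
by apply: (same_sign _ _ _ _ g01 e_gt0); field; rewrite g0N0 g1N0 dgN0.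
Qed.

(** With [e] equal to 1 or -1 according to the sign of [g * zdiff g], the conclusion concerns the
    quotient or its negative. *)
Lemma down_up_scaled_quot a b f g (e : R) :
  nonzero_on (zint a b) g -> constant_sign_on (zint a b) g ->
  nonzero_on (zint (a + 1)%E b) (zdiff g) ->
  nondecreasing_on (zint (a + 1)%E b) (zquot (zdiff f) (zdiff g)) ->
  {in zint (a + 1)%E b, forall n, 0 < e * (g n * zdiff g n)} ->
  down_up a b (fun n => e * zquot f g n).
Proof.
move=> gN0 g_sg dgN0 rho_incr e_gt0.
have riseE n (n_in : n \in zint (a + 1)%E b) :
    ((e * zquot f g (n - 1) <= e * zquot f g n) =
       (zquot f g (n - 1) <= zquot (zdiff f) (zdiff g) n)) *
    ((e * zquot f g (n - 1) <= e * zquot f g n) =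
       (zquot f g n <= zquot (zdiff f) (zdiff g) n)).
  have [n1_in' n_in'] : n - 1 \in zint a b /\ n \in zint a b.
    by apply/andP; rewrite -zint_succE.
  apply: quot_rise_rho; [exact: gN0 | exact: gN0 | exact: dgN0 | exact: g_sg |].
  exact: e_gt0.
apply: down_up_of_persistent_rise => n n_in n1_in.
(* The second criterion at [n] and the first at [n + 1] both compare with the quotient at [n], so
   monotonicity of the ratio of differences links them. *)
rewrite (riseE n n_in).2 => r_le_rho.
have := (riseE _ n1_in).1; rewrite addrK => ->.
by apply: le_trans r_le_rho _; apply: rho_incr; rewrite // lerDl.
Qed.

End Sequences.

Theorem theorem1 (R : realType) (a b : \bar int) (f g : int -> R)
    (g_neq0 : nonzero_on (zint a b) g)
    (g_sign : constant_sign_on (zint a b) g)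
    (dg_neq0 : nonzero_on (zint (a + 1)%E b) (zdiff g))
    (dg_sign : constant_sign_on (zint (a + 1)%E b) (zdiff g)) :
  let r := zquot f g in
  let rho := zquot (zdiff f) (zdiff g) in
  let I1 := zint (a + 1)%E b in
  (nondecreasing_on I1 rho \/ nonincreasing_on I1 rho) ->
  [/\ nondecreasing_on I1 rho ->
        {in I1, forall n, 0 < g n * zdiff g n} -> down_up a b r,
      nonincreasing_on I1 rho ->
        {in I1, forall n, 0 < g n * zdiff g n} -> up_down a b r,
      nondecreasing_on I1 rho ->
        {in I1, forall n, g n * zdiff g n < 0} -> up_down a b r
    & nonincreasing_on I1 rho ->
        {in I1, forall n, g n * zdiff g n < 0} -> down_up a b r].
Proof.
move=> r rho I1 _.
(* Negating [f] alone negates both [r] and [rho], so a nonincreasing [rho] becomes nondecreasing. *)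
pose Nf n := - f n.
have NfE n : zquot Nf g n = - r n by rewrite /zquot mulNr.
have rhoNE n : zquot (zdiff Nf) (zdiff g) n = - rho n.
  by rewrite /rho /zquot -mulNr /zdiff opprD.
have Nrho_incr : nonincreasing_on I1 rho ->
    nondecreasing_on I1 (zquot (zdiff Nf) (zdiff g)).
  by rewrite (funext rhoNE) => /nonincreasing_onN.
have pos1 : {in I1, forall n, 0 < g n * zdiff g n} ->
    {in I1, forall n, 0 < 1 * (g n * zdiff g n)}.
  by move=> h n /h; rewrite mul1r.
have posN1 : {in I1, forall n, g n * zdiff g n < 0} ->
    {in I1, forall n, 0 < - 1 * (g n * zdiff g n)}.
  by move=> h n /h; rewrite mulN1r oppr_gt0.
split=> [rho_mono|/Nrho_incr rho_mono|rho_mono|/Nrho_incr rho_mono] gdg_sg;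
  [have := pos1 gdg_sg | have := pos1 gdg_sg | have := posN1 gdg_sg
  | have := posN1 gdg_sg];
  move/(down_up_scaled_quot g_neq0 g_sign dg_neq0 rho_mono).
(* The sequences now known to go down, then up are [r], [- r], [- r] and [r]: in the last case the
   signs from [e] and [Nf] cancel. *)
- by under eq_fun do rewrite mul1r.
- by under eq_fun do rewrite mul1r NfE; apply: up_downN.
- by under eq_fun do rewrite mulN1r; apply: up_downN.
- by under eq_fun do rewrite mulN1r NfE opprK.
Qed.
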